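(* Let $k$, $r$, $w$ and $h$ be positive integers with $w \ge k \ge 3$ and $h \ge 3$. Suppose there exist a $k$-$\mathrm{GDD}$ of type $h^k$, a Steiner system $S(2,k,h)$, and a $\mathrm{PENT}(k,r,w)$ with a connected deficiency graph. Then there exists a $\mathrm{PENT}(k, hr + (h-1)/(k-1), hw)$ with a connected deficiency graph of girth $4$.
   Context: A partial linear space is a (finite) set of points together with a set of lines, each line identified with the set of points incident with it, such that two distinct points lie on at most one common line. Two points are collinear if some line contains both (so a point that lies on a line is collinear with itself). A Steiner system $S(2,k,w)$ is a set of $w$ points with a collection of $k$-subsets (blocks) such that each pair of distinct points is contained in exactly one block. A generalized pentagonal geometry $\mathrm{PENT}(k,r,w)$ is a partial linear space in which every line has exactly $k$ points, every point is on exactly $r$ lines, and for every point $x$ the set of points not collinear with $x$ has size $w$ and is the point set of a Steiner system $S(2,k,w)$ whose blocks are lines of the geometry. Its deficiency graph has the points of the geometry as vertices, with $x \sim y$ precisely when $x$ and $y$ are not collinear. A $k$-$\mathrm{GDD}$ (group divisible design) of type $h^k$ is a triple $(V,\mathcal{G},\mathcal{B})$ where $V$ is a set of $hk$ points, $\mathcal{G}$ is a partition of $V$ into $k$ subsets (groups) of size $h$, and $\mathcal{B}$ is a non-empty collection of $k$-subsets of $V$ (blocks) such that each pair of points from distinct groups lies in exactly one block and no pair of points from the same group lies in any block. *)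

(* Defs.v *)
From mathcomp Require Import all_boot.

Set Implicit Arguments.
Unset Strict Implicit.
Unset Printing Implicit Defensive.

Section Designs.
Variable T : finType.
Implicit Types (D : {set T}) (L B G : {set {set T}}) (x y : T).

(* A Steiner system S(2,k,w) with point set D, a subset of the ambient type,
   so that the notion also applies to the systems embedded in a geometry. *)
Definition is_steiner (k w : nat) D B : Prop :=
  [/\ #|D| = w,
      forall b, b \in B -> b \subset D /\ #|b| = k
    & forall x y, x \in D -> y \in D -> x != y ->
        exists! b, [/\ b \in B, x \in b & y \in b]].

Definition is_gdd (k h : nat) G B : Prop :=
  [/\ #|T| = h * k,
      [/\ partition G [set: T], #|G| = k & forall g, g \in G -> #|g| = h],
      B != set0 /\ (forall b, b \in B -> #|b| = k),
      forall g g' x y, g \in G -> g' \in G -> g != g' ->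
        x \in g -> y \in g' ->
        exists! b, [/\ b \in B, x \in b & y \in b]
    & forall g x y, g \in G -> x \in g -> y \in g -> x != y ->
        ~ exists b, [/\ b \in B, x \in b & y \in b]].

Definition partial_linear_space L : Prop :=
  forall x y, x != y -> forall l l', l \in L -> l' \in L ->
    x \in l -> y \in l -> x \in l' -> y \in l' -> l = l'.

Definition collinear L : rel T :=
  fun x y => [exists l in L, (x \in l) && (y \in l)].

(* No loops occur as soon as every point is on at least one line. *)
Definition deficiency L : rel T := fun x y => ~~ collinear L x y.

Definition is_pent (k r w : nat) L : Prop :=
  [/\ partial_linear_space L,
      forall l, l \in L -> #|l| = k,
      forall x, #|[set l in L | x \in l]| = r
    & forall x, exists2 B : {set {set T}}, B \subset L &
        is_steiner k w [set y | ~~ collinear L x y] B].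

(* The graph without vertices is not connected. *)
Definition connected_graph (e : rel T) : Prop :=
  0 < #|T| /\ forall x y, connect e x y.

(* ucycle also accepts sequences of size less than 3, which are not cycles of
   a simple graph.  An acyclic graph has no (finite) girth g. *)
Definition graph_cycle (e : rel T) (c : seq T) : Prop :=
  2 < size c /\ ucycle e c.

Definition has_girth (e : rel T) (g : nat) : Prop :=
  (exists2 c, graph_cycle e c & size c = g) /\
  (forall c, graph_cycle e c -> g <= size c).

End Designs.

(* Main.v *)
Require Import Defs.
From mathcomp Require Import all_boot.

(** Give every point of the pentagonal geometry a weight: replace the point set
    P by P x S, where S is the point set of the Steiner system S(2,k,h).  Each
    fibre {x} x S receives a copy of the Steiner system.  Over each line l, the
    set l x S has k fibres of size h, so it receives a copy of the GDD whose
    groups are these fibres ([gdd_transport]).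

    Two points in different fibres lie on a common new block exactly when their
    projections are collinear, and two points of the same fibre always do.
    Hence p and q are collinear exactly when their projections are
    ([collinear_inflation]).  The points not collinear with p therefore form
    D x S, where D is the set of points not collinear with the projection of p.
    Since D carries a Steiner system made of lines, the new lines inside D x S
    form a Steiner system too.

    The number of lines on a point follows without counting the blocks of the
    GDD or of the Steiner system.  In any partial linear space with lines of
    size k, a point on r lines has r (k - 1) other points collinear with it
    ([lines_through_point]).  Using this in the old and in the new geometry
    gives r' (k - 1) = h r (k - 1) + (h - 1).

    The new deficiency graph is the blow-up of the old one, in which each vertex
    becomes h independent vertices.  Two twins and two copies of a neighbour
    form a 4-cycle, while no deficiency graph has a triangle: two distinct
    points not collinear with x are on a common block of the Steiner system
    attached to x, hence collinear ([pent_triangle_free]). *)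

Set Implicit Arguments.
Unset Strict Implicit.
Unset Printing Implicit Defensive.

(** * Partial linear spaces and pentagonal geometries *)

Section Geometry.
Variables (T : finType) (L : {set {set T}}).

Lemma collinearP x y :
  reflect (exists l, [/\ l \in L, x \in l & y \in l]) (collinear L x y).
Proof.
apply: (iffP existsP) => [[l /and3P[lL xl yl]]|[l [lL xl yl]]]; exists l => //.
by apply/and3P.
Qed.

Lemma collinear_sym : symmetric (collinear L).
Proof. by move=> x y; apply: eq_existsb => l; rewrite (andbC (x \in l)). Qed.

Lemma deficiency_sym : symmetric (deficiency L).
Proof. by move=> x y; rewrite /deficiency collinear_sym. Qed.

Lemma collinear_refl r x :
  0 < r -> #|[set l in L | x \in l]| = r -> collinear L x x.
Proof.
move=> r_gt0 Er; move: r_gt0; rewrite -Er => /card_gt0P[l].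
by rewrite inE => /andP[lL xl]; apply/collinearP; exists l.
Qed.

(** Double counting of the flags (l, y) with l a line on x and y another point
    of l: such a y determines l. *)
Lemma lines_through_point k x :
  partial_linear_space L -> (forall l, l \in L -> #|l| = k) ->
  collinear L x x ->
  #|[set l in L | x \in l]| * (k - 1) + #|[set y | ~~ collinear L x y]| + 1
    = #|T|.
Proof.
move=> pls lk xx; set F := [set l in L | x \in l].
have -> : #|F| * (k - 1) = #|[set y | collinear L x y] :\ x|.
  transitivity (\sum_(l in F) \sum_(y | y != x) (y \in l)).
    rewrite -sum_nat_const; apply: eq_bigr => l; rewrite inE => /andP[lL xl].
    rewrite -(lk l lL) (cardsD1 x l) xl addnC addnK.
    rewrite -sum1_card [LHS]big_mkcond [RHS]big_mkcond /=; apply: eq_bigr => y _.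
    by rewrite !inE; case: (y == x); case: (y \in l).
  rewrite exchange_big /= -sum1_card [LHS]big_mkcond [RHS]big_mkcond /=.
  apply: eq_bigr => y _; rewrite !inE; case: eqP => [//|/eqP yx] /=.
  case: collinearP => [[l [lL xl yl]]|nc]; last first.
    apply: big1 => l; rewrite inE => /andP[lL xl].
    by case yl: (y \in l) => //; case: nc; exists l.
  rewrite (bigD1 l) ?inE ?lL ?xl //= yl big1 // => m; rewrite inE.
  move=> /andP[/andP[mL xm] ml]; case ym: (y \in m) => //.
  by case/eqP: ml; apply: (pls y x yx m l).
have <- : ~: [set y | collinear L x y] = [set y | ~~ collinear L x y].
  by apply/setP => y; rewrite !inE.
rewrite -(cardsC [set y | collinear L x y]) [in RHS](cardsD1 x) inE xx.
by rewrite -[RHS]addnA addnC.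
Qed.

(** The points not collinear with x carry a Steiner system whose blocks are
    lines, so any two of them are collinear. *)
Lemma pent_triangle_free k r w x y z :
  is_pent k r w L -> deficiency L x y -> deficiency L x z -> y != z ->
  collinear L y z.
Proof.
move=> [_ _ _ /(_ x)[B /subsetP BL [_ _ ex]]] xy xz yz.
have [||b [[bB yb zb] _]] := ex y z _ _ yz; rewrite ?inE //.
by apply/collinearP; exists b; split=> //; apply: BL.
Qed.

Lemma pent_deficiency_neighbour k r w x :
  is_pent k r w L -> 0 < w -> exists y, deficiency L x y.
Proof.
move=> [_ _ _ /(_ x)[B _ [cD _ _]]]; rewrite -cD => /card_gt0P[y].
by rewrite inE => xy; exists y.
Qed.

End Geometry.

(** * Transport of a group divisible design *)

Section Transfer.
Variables (T U : finType) (u0 : U) (A : {set T}) (B : {set U}).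

(** For sets of the same size, the bijection that matches their enumerations; it
    is total so that it can be applied without a proof of membership. *)
Definition transfer (x : T) : U := nth u0 (enum B) (index x (enum A)).

Hypothesis cardAB : #|A| = #|B|.

Lemma index_transfer x : x \in A -> index x (enum A) < size (enum B).
Proof. by move=> xA; rewrite -cardE -cardAB cardE index_mem mem_enum. Qed.

Lemma transfer_in x : x \in A -> transfer x \in B.
Proof. by move=> xA; rewrite -mem_enum mem_nth ?index_transfer. Qed.

Lemma transfer_inj : {in A &, injective transfer}.
Proof.
move=> x y xA yA /eqP.
rewrite nth_uniq ?enum_uniq ?index_transfer // => /eqP.
by apply: index_inj; rewrite ?mem_enum.
Qed.

End Transfer.

Section Fibred.
Variables (P S : finType).
Implicit Types (l : {set P}) (M : {set {set P * S}}) (p q : P * S).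

(** A GDD on l x S whose groups are the fibres {x} x S for x in l. *)
Definition fibred_gdd k l M : Prop :=
  [/\ forall b, b \in M -> b \subset setX l [set: S] /\ #|b| = k,
      forall p q, p.1 \in l -> q.1 \in l -> p.1 != q.1 ->
        exists! b, [/\ b \in M, p \in b & q \in b]
    & forall b, b \in M -> {in b &, injective fst}].

(** The groups of the GDD are matched with the points of l, and each group with
    S.  The resulting injection of V into P x S has image l x S, because both
    sets have h k elements. *)
Lemma gdd_transport (V : finType) (G B : {set {set V}}) k h l :
  is_gdd k h G B -> 0 < k -> 0 < h -> #|S| = h -> #|l| = k ->
  exists M, fibred_gdd k l M.
Proof.
move=> [cV [partG cG cg] [_ Bk] ex no] k_gt0 h_gt0 cS cl.
have [x0 _] : exists x, x \in l by apply/card_gt0P; rewrite cl.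
have [s0 _] : exists s, s \in S by apply/card_gt0P; rewrite cS.
have [/eqP covG trivG _] := and3P partG.
have Vcov v : v \in cover G by rewrite covG.
have pG v : pblock G v \in G by rewrite pblock_mem.
have vp v : v \in pblock G v by rewrite mem_pblock.
have cgS g : g \in G -> #|g| = #|[set: S]| by move=> /cg ->; rewrite cardsT cS.
(* The group of v selects the fibre, the rank of v in its group the point. *)
pose f v := (transfer x0 G l (pblock G v),
             transfer s0 (pblock G v) [set: S] v).
have Gl : #|G| = #|l| by rewrite cG cl.
have f1 u v : (f u).1 = (f v).1 -> pblock G u = pblock G v.
  by apply: (transfer_inj Gl).
have f_inj : injective f.
  move=> u v fuv; have Euv := f1 u v (congr1 fst fuv).
  move/(congr1 snd): fuv; rewrite /= -Euv.
  by apply: (transfer_inj (cgS _ (pG u))); rewrite ?vp // Euv vp.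
have fl v : (f v).1 \in l by apply: (transfer_in _ Gl).
have imf : f @: [set: V] = setX l [set: S].
  apply/eqP; rewrite eqEcard; apply/andP; split.
    by apply/subsetP => _ /imsetP[v _ ->]; rewrite inE fl inE.
  by rewrite card_imset // cardsX !cardsT cV cl cS mulnC.
have f_surj p : p.1 \in l -> exists v, p = f v.
  move=> pl; have : p \in f @: [set: V] by rewrite imf inE pl inE.
  by case/imsetP => v _ ->; exists v.
exists [set f @: (b : {set V}) | b in B]; split.
- move=> _ /imsetP[b bB ->]; rewrite card_imset ?Bk //; split=> //.
  by rewrite -imf imsetS ?subsetT.
- move=> p q /f_surj[u ->] /f_surj[v ->] fuv.
  have uv : pblock G u != pblock G v.
    by apply: contraNneq fuv => uv; rewrite /f uv.
  have [b [[bB ub vb] uniq_b]] := ex _ _ _ _ (pG u) (pG v) uv (vp u) (vp v).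
  exists (f @: b); split; first by split; rewrite ?imset_f.
  move=> _ [/imsetP[c cB ->]]; rewrite !mem_imset // => uc vc.
  by rewrite (uniq_b c).
- move=> _ /imsetP[b bB ->] _ _ /imsetP[u ub ->] /imsetP[v vb ->] /f1 uv.
  have [->//|neq_uv] := eqVneq u v.
  case: (no _ u v (pG u) (vp u) _ neq_uv); first by rewrite uv vp.
  by exists b.
Qed.

End Fibred.

(** * Inflation of a geometry *)

Section Inflation.
Variables (P S : finType) (L : {set {set P}}) (BS : {set {set S}}).
Variables (M : {set P} -> {set {set P * S}}) (k h : nat).

Definition inflation : {set {set P * S}} :=
  [set pair x @: (b : {set S}) | x in [set: P], b in BS]
    :|: \bigcup_(l in L) M l.

Hypotheses (steinerS : is_steiner k h [set: S] BS) (h_gt1 : 1 < h).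
Hypothesis gddM : forall l, l \in L -> fibred_gdd k l (M l).
Hypotheses (pls : partial_linear_space L) (xx : forall x, collinear L x x).

Lemma inflationP m :
  reflect ((exists x, exists2 b, b \in BS & m = pair x @: b) \/
           (exists2 l, l \in L & m \in M l))
          (m \in inflation).
Proof.
apply: (iffP setUP) => [[/imset2P[x b _ bB ->]|/bigcupP[l lL ml]]|].
- by left; exists x, b.
- by right; exists l.
case=> [[x [b bB ->]]|[l lL ml]]; [left|right].
  by apply/imset2P; exists x b; rewrite ?inE.
by apply/bigcupP; exists l.
Qed.

Lemma pair_inj (x : P) : injective (@pair P S x).
Proof. by move=> s t []. Qed.

Lemma inflation_fibre_line p q : p.1 = q.1 -> p != q ->
  exists m, [/\ m \in inflation, p \in m, q \in m
              & m \subset setX [set p.1] [set: S]].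
Proof.
case: p q => [x s] [y t] /= <-; rewrite xpair_eqE eqxx /= => st.
have [_ _ ex] := steinerS.
have [||b [[bB sb tb] _]] := ex s t _ _ st; rewrite ?inE //.
exists (pair x @: b); split; rewrite ?imset_f //.
  by apply/inflationP; left; exists x, b.
by apply/subsetP => _ /imsetP[u _ ->]; rewrite !inE eqxx.
Qed.

Lemma inflation_cross_line l p q :
  l \in L -> p.1 \in l -> q.1 \in l -> p.1 != q.1 ->
  exists m, [/\ m \in inflation, p \in m, q \in m & m \subset setX l [set: S]].
Proof.
move=> lL pl ql pq; have [sub ex _] := gddM lL.
have [m [[mM pm qm] _]] := ex p q pl ql pq.
exists m; split=> //; last by case: (sub m mM).
by apply/inflationP; right; exists l.
Qed.

(** Adding the fibre lines makes twins collinear; the lines over l join just the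
    points above collinear pairs. *)
Lemma collinear_inflation p q :
  collinear inflation p q = collinear L p.1 q.1.
Proof.
apply/collinearP/idP => [[m [/inflationP[[x [b _ ->]]|[l lL ml]] pm qm]]|].
- case/imsetP: pm => s _ ->; case/imsetP: qm => t _ -> /=; exact: xx.
- have [/(_ m ml)[/subsetP sub _] _ _] := gddM lL.
  apply/collinearP; exists l; split=> //.
    by have := sub p pm; rewrite !inE andbT.
  by have := sub q qm; rewrite !inE andbT.
case/collinearP => l [lL pl ql]; have [pq1|pq1] := eqVneq p.1 q.1; last first.
  by have [m [mI pm qm _]] := inflation_cross_line lL pl ql pq1; exists m.
have [pq|pq] := eqVneq p q; last first.
  by have [m [mI pm qm _]] := inflation_fibre_line pq1 pq; exists m.
(* A line on p alone comes from a second point of its fibre. *)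
have [cS _ _] := steinerS.
have /card_gt0P[t] : 0 < #|[set: S] :\ p.2|.
  by move: h_gt1; rewrite -cS (cardsD1 p.2) in_setT add1n ltnS.
rewrite !inE andbT => tp.
have [||m [mI pm _ _]] := @inflation_fibre_line p (p.1, t) => //.
  by apply: contraNneq tp => ->.
by exists m; rewrite -pq.
Qed.

(** A fibre line and a line over some l share at most one point, since the
    latter meets each fibre at most once.  Two lines over l and l' with two
    common points project to two common points of l and l', so l = l' and both
    are blocks of the same GDD. *)
Lemma inflation_partial_linear : partial_linear_space inflation.
Proof.
have [_ _ exS] := steinerS.
have fibre_cross x (b : {set S}) l m p q : l \in L -> m \in M l -> p != q ->
    p \in pair x @: b -> q \in pair x @: b -> p \in m -> q \in m -> False.
  move=> lL ml /eqP pq /imsetP[s _ Ep] /imsetP[t _ Eq] pm qm; apply: pq.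
  have [_ _ inj] := gddM lL; apply: (inj m ml) => //; by rewrite Ep Eq.
move=> p q pq m m' /inflationP[[x [b bB ->]]|[l lL ml]];
  move=> /inflationP[[x' [b' bB' ->]]|[l' lL' ml']] pm qm pm' qm'.
- case/imsetP: pm pq pm' qm' => s sb -> pq.
  case/imsetP: qm pq => t tb ->; rewrite xpair_eqE eqxx /= => st.
  case/imsetP => s' sb' [-> Es]; case/imsetP => t' tb' [Et].
  rewrite -{}Es in sb'; rewrite -{}Et in tb'.
  have [||c [_ uniq_c]] := exS s t _ _ st; rewrite ?inE //.
  by rewrite -(uniq_c b) // -(uniq_c b').
- by case: (fibre_cross x b l' m' p q).
- by case: (fibre_cross x' b' l m p q).
have [sub ex inj] := gddM lL; have [sub' _ _] := gddM lL'.
have pq1 : p.1 != q.1.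
  by apply: contraNneq pq => pq1; apply/eqP; apply: (inj m ml).
have inl n y : n \in M l -> y \in n -> y.1 \in l.
  by case/sub=> /subsetP s _ /s; rewrite !inE andbT.
have inl' n y : n \in M l' -> y \in n -> y.1 \in l'.
  by case/sub'=> /subsetP s _ /s; rewrite !inE andbT.
have El : l = l' by apply: (pls pq1); eauto.
rewrite -{}El in ml' *.
have [||c [_ uniq_c]] := ex p q _ _ pq1; eauto.
by rewrite -(uniq_c m) // -(uniq_c m').
Qed.

Lemma inflation_line_card m : m \in inflation -> #|m| = k.
Proof.
case/inflationP => [[x [b bB ->]]|[l lL ml]].
  have [_ /(_ b bB)[_ bk] _] := steinerS.
  by rewrite card_imset //; apply: pair_inj.
by have [/(_ m ml)[]] := gddM lL.
Qed.

Lemma inflation_noncollinear p :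
  [set q | ~~ collinear inflation p q]
    = setX [set y | ~~ collinear L p.1 y] [set: S].
Proof. by apply/setP => q; rewrite !inE collinear_inflation andbT. Qed.

(** The lines inside D x S, with D the point set of the Steiner system attached
    to the projection of p, form the Steiner system attached to p: a pair in a
    fibre is joined inside the fibre, and any other pair over the block of D
    that joins its projections. *)
Lemma inflation_pent r w : 1 < k ->
  is_pent k r w L -> is_pent k (h * r + (h - 1) %/ (k - 1)) (h * w) inflation.
Proof.
move=> k_gt1 [_ lk Lr stL]; have [cS _ _] := steinerS; rewrite cardsT in cS.
split.
- exact: inflation_partial_linear.
- exact: inflation_line_card.
- move=> p; set r' := #|_|.
  have [B _ [cD _ _]] := stL p.1.
  have := lines_through_point pls lk (xx p.1); rewrite Lr cD => cP.
  have cP' : r' * (k - 1) + h * w + 1 = #|{: P * S}|.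
    have := lines_through_point inflation_partial_linear inflation_line_card.
    move/(_ p); rewrite collinear_inflation => /(_ (xx _)).
    by rewrite inflation_noncollinear cardsX cardsT cS cD (mulnC w).
  (* The two counts also give the divisibility of h - 1 by k - 1. *)
  have Er : r' * (k - 1) = h * r * (k - 1) + (h - 1).
    apply: (@addIn (h * w + 1)); rewrite addnA cP' card_prod -cP cS.
    rewrite mulnC !mulnDr muln1 mulnA -!addnA; congr (_ + _).
    by rewrite addnCA subnK // ltnW.
  by rewrite -divnMDl ?subn_gt0 // -Er mulnK // subn_gt0.
move=> p; have [B /subsetP BL [cD BD ex]] := stL p.1.
rewrite inflation_noncollinear; set D := [set y | _] in cD BD ex *.
exists [set m in inflation | m \subset setX D [set: S]].
  by apply/subsetP => m; rewrite inE => /andP[].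
split; first by rewrite cardsX cD cardsT cS mulnC.
  by move=> m; rewrite inE => /andP[mI ->]; rewrite inflation_line_card.
(* Uniqueness of the line on two points holds in the whole inflation. *)
suff exD u v : u.1 \in D -> v.1 \in D -> u != v ->
    exists m, [/\ m \in inflation, u \in m, v \in m
                & m \subset setX D [set: S]].
  move=> u v; rewrite [u \in _]inE [v \in _]inE => /andP[uD _] /andP[vD _] uv.
  have [m [mI um vm mD]] := exD u v uD vD uv.
  exists m; split; first by rewrite inE mI.
  move=> m' []; rewrite inE => /andP[mI' _] um' vm'.
  exact: (inflation_partial_linear uv).
move=> uD vD uv; have [uv1|uv1] := eqVneq u.1 v.1.
  have [m [mI um vm sub]] := inflation_fibre_line uv1 uv.
  exists m; split=> //; apply: subset_trans sub _.
  by apply: setXS => //; rewrite sub1set.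
have [b [[bB ub vb] _]] := ex _ _ uD vD uv1.
have [m [mI um vm sub]] := inflation_cross_line (BL b bB) ub vb uv1.
exists m; split=> //; apply: subset_trans sub _.
by apply: setXS => //; case: (BD b bB).
Qed.

End Inflation.

(** * The blow-up of a graph *)

Section BlowUp.
Variables (P S : finType) (e : rel P).

Definition blow_up : rel (P * S) := fun p q => e p.1 q.1.

(** A lifted walk may end at the wrong copy of its last vertex, and a trivial
    walk cannot join two twins.  Both problems disappear if the walk is led to a
    neighbour of the target vertex first: from any copy of that neighbour, one
    more step reaches every copy of the target. *)
Lemma blow_up_connected :
  symmetric e -> (forall x, exists y, e x y) -> 0 < #|S| ->
  connected_graph e -> connected_graph blow_up.
Proof.
move=> e_sym nbr S_gt0 [P_gt0 conn]; split=> [|p q].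
  by rewrite card_prod muln_gt0 P_gt0.
have lift z p' : forall c, path e p'.1 c -> z = last p'.1 c ->
    exists s, connect blow_up p' (z, s).
  move=> c; elim: c p' => [|y c IHc] p' /=.
    by move=> _ ->; exists p'.2; case: p' => *; apply: connect0.
  case/andP=> py /(IHc (y, p'.2)) IH /IH[s con]; exists s.
  by apply: connect_trans con; apply: connect1.
have [y qy] := nbr q.1.
have /connectP[c ec yc] := conn p.1 y.
have [s py] := lift y p c ec yc.
by apply: connect_trans py _; apply: connect1; rewrite /blow_up /= e_sym.
Qed.

(** A closed walk of length 3 projects to one of e, so the blow-up has no
    triangle either; the edge xy, doubled at both ends, is the 4-cycle. *)
Lemma blow_up_girth4 x y :
  symmetric e -> irreflexive e -> e x y -> 1 < #|S| ->
  (forall u v z, e u v -> e v z -> e z u -> False) -> has_girth blow_up 4.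
Proof.
move=> e_sym e_irr xy /card_gt1P[s [t [_ _ st]]] no3; split.
  have neq_xy : x != y by apply: contraTneq xy => ->; rewrite e_irr.
  exists [:: (x, s); (y, s); (x, t); (y, t)] => //; split=> //.
  rewrite /ucycle /blow_up /= xy (e_sym y x) xy /= !inE !xpair_eqE !eqxx.
  by rewrite (eq_sym y x) (negPf neq_xy) (negPf st).
move=> [|u [|v [|z [|? ?]]]] [] //= _ /andP[/and4P[uv vz zu _] _].
by case: (no3 u.1 v.1 z.1).
Qed.

End BlowUp.

Theorem theorem3p3 (k r w h : nat)
  (r_gt0 : 0 < r) (k_ge3 : 3 <= k) (w_gek : k <= w) (h_ge3 : 3 <= h)
  (gddE : exists (V : finType) (G B : {set {set V}}), is_gdd k h G B)
  (steinerE : exists (V : finType) (B : {set {set V}}),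
     is_steiner k h [set: V] B)
  (pentE : exists (P : finType) (L : {set {set P}}),
     is_pent k r w L /\ connected_graph (deficiency L)) :
  exists (P : finType) (L : {set {set P}}),
    [/\ is_pent k (h * r + (h - 1) %/ (k - 1)) (h * w) L,
        connected_graph (deficiency L)
      & has_girth (deficiency L) 4].
Proof.
have [V [G [B gdd]]] := gddE.
have [S [BS stS]] := steinerE.
have [P [L [pent conn]]] := pentE.
have [pls lk Lr _] := pent.
have cS : #|S| = h by have [] := stS; rewrite cardsT.
have h_gt1 : 1 < h by apply: ltnW.
have k_gt1 : 1 < k by apply: ltnW.
have xx x : collinear L x x by apply: collinear_refl r_gt0 (Lr x).
have w_gt0 : 0 < w by apply: leq_trans w_gek; apply: ltnW.
have [M gddM] : exists M : {set P} -> {set {set P * S}},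
    forall l, l \in L -> fibred_gdd k l (M l).
  apply: (@fin_all_exists _ (fun=> {set {set P * S}})
            (fun l M => l \in L -> fibred_gdd k l M)) => l.
  have [lL|_] := boolP (l \in L); last by exists set0.
  have [N gddN] : exists N, @fibred_gdd P S k l N.
    by apply: (gdd_transport gdd); rewrite ?lk // ltnW.
  by exists N.
exists (P * S)%type, (inflation L BS M).
have pentI := inflation_pent stS h_gt1 gddM pls xx k_gt1 pent.
have defI : deficiency (inflation L BS M) =2 blow_up (deficiency L).
  move=> p q; congr (~~ _).
  exact: collinear_inflation stS h_gt1 gddM xx p q.
have nbr x := pent_deficiency_neighbour x pent w_gt0.
have sym := deficiency_sym L.
split=> //.
  have [PS_gt0 connB] : connected_graph (@blow_up P S (deficiency L)).
    by apply: blow_up_connected => //; rewrite cS ltnW.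
  by split=> // p q; rewrite (eq_connect defI).
have [x0 _] : exists x : P, x \in P by case: conn => /card_gt0P.
have [y0 xy0] := nbr x0.
have irr : irreflexive (deficiency L).
  by move=> x; apply/negbTE; rewrite /deficiency negbK.
have [||[c [c3 /andP[cyc uniq_c]] c4] min4] :=
  @blow_up_girth4 P S _ x0 y0 sym irr xy0.
- by rewrite cS.
- move=> u v z uv vz zu; apply: (negP vz).
  apply: (pent_triangle_free pent uv); first by rewrite sym.
  by apply: contraTneq vz => ->; rewrite irr.
split.
  by exists c => //; split=> //; apply/andP; split; rewrite ?(eq_cycle defI).
move=> d [d3 /andP[cyc_d uniq_d]]; apply: min4; split=> //.
by apply/andP; split; rewrite -?(eq_cycle defI).
Qed.
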